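(* Let $P_1$ be the class consisting of the following maps of finite topological spaces: $$\{a,b\}\to\{\bullet\},\qquad \{a\}\to\{a\leftrightarrow b\},\qquad \{o\to c\}\to\{o\leftrightarrow c\},\qquad \{a\leftarrow u\to b\}\to\{u\to c\}.$$ A topological space $Q$ is totally disconnected if and only if the map $Q\to\{\bullet\}$ belongs to $(P_1)^{lr}$.
   Context: All maps are continuous. $\{\bullet\}$ is the one-point space; $\{a,b\}$ is the discrete two-point space. $\{a\leftrightarrow b\}$ is the indiscrete two-point space and $\{a\}\to\{a\leftrightarrow b\}$ is the inclusion. $\{o\to c\}$ is the Sierpinski space with open point $o$ and closed point $c$, and $\{o\to c\}\to\{o\leftrightarrow c\}$ is the identity on points to the indiscrete space. $\{a\leftarrow u\to b\}$ has one open point $u$ and two closed points $a,b$ (open sets $\emptyset,\{u\},\{a,u\},\{u,b\},\{a,u,b\}$), $\{u\to c\}$ is the Sierpinski space with open point $u$ and closed point $c$, and the last map sends $u\mapsto u$, $a,b\mapsto c$. A map $f:A\to B$ has the left lifting property with respect to $g:X\to Y$, written $f\pitchfork g$, if for all $t:A\to X$, $s:B\to Y$ with $g\circ t=s\circ f$ there is $h:B\to X$ with $h\circ f=t$ and $g\circ h=s$. For a class $P$ of maps, $P^l=\{f:\ f\pitchfork g \text{ for all } g\in P\}$, $P^r=\{g:\ f\pitchfork g\text{ for all } f\in P\}$, $P^{lr}=(P^l)^r$. A space is totally disconnected if each connected subset of it consists of a single point. *)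

(* Defs.v *)
From HB Require Import structures.
From mathcomp Require Import all_boot.
From mathcomp Require Import all_classical topology.
From mathcomp Require Import separation_axioms.

Set Implicit Arguments.
Unset Strict Implicit.
Unset Printing Implicit Defensive.

Local Open Scope classical_set_scope.

(* A class of continuous maps between topological spaces. The domain and
   codomain may be empty: topologicalType is not pointed. *)
Definition map_class := forall X Y : topologicalType, continuousType X Y -> Prop.

Definition lifts (A B X Y : topologicalType)
    (f : continuousType A B) (g : continuousType X Y) : Prop :=
  forall (t : continuousType A X) (s : continuousType B Y),
    g \o t = s \o f ->
    exists h : continuousType B X, h \o f = t /\ g \o h = s.

Definition left_class (P : map_class) : map_class := fun A B f =>
  forall (X Y : topologicalType) (g : continuousType X Y), P X Y g -> lifts f g.

Definition right_class (P : map_class) : map_class := fun X Y g =>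
  forall (A B : topologicalType) (f : continuousType A B), P A B f -> lifts f g.

Definition left_right_class (P : map_class) : map_class :=
  right_class (left_class P).

Definition point_space : topologicalType := discrete_topology unit.

Definition two_point_space : topologicalType := discrete_topology bool.

Definition indiscrete_topology (T : Type) : Type := T.

Section indiscrete.
Variable T : choiceType.

Definition indiscrete_open : set_system (indiscrete_topology T) :=
  [set set0; setT].

Lemma indiscrete_openP (U : set (indiscrete_topology T)) :
  indiscrete_open U <-> (forall x y, U x -> U y).
Proof.
split=> [[->|->] //|UU].
have [[x Ux]|/set0P/negP] := pselect (U !=set0).
  by right; rewrite /= -subTset => y _; exact: UU Ux.
by rewrite negbK => /eqP; left.
Qed.

Let indiscreteT : indiscrete_open setT. Proof. by right. Qed.

Let indiscreteI : setI_closed indiscrete_open.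
Proof.
move=> U V /indiscrete_openP UU /indiscrete_openP VV.
by apply/indiscrete_openP => x y [/UU Uy /VV Vy]; split.
Qed.

Let indiscrete_bigU (I : Type) (F : I -> set (indiscrete_topology T)) :
  (forall i, indiscrete_open (F i)) -> indiscrete_open (\bigcup_i F i).
Proof.
move=> FO; apply/indiscrete_openP => x y [i _ Fx].
by exists i => //; have /indiscrete_openP := FO i; apply; exact: Fx.
Qed.

HB.instance Definition _ := Choice.copy (indiscrete_topology T) T.
HB.instance Definition _ := isOpenTopological.Build (indiscrete_topology T)
  indiscreteT indiscreteI indiscrete_bigU.

Lemma indiscrete_openE : @open (indiscrete_topology T) = indiscrete_open.
Proof. by []. Qed.

End indiscrete.

Lemma indiscrete_continuous (X : topologicalType) (T : choiceType)
  (f : X -> indiscrete_topology T) : continuous f.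
Proof.
apply/continuousP => U; rewrite indiscrete_openE => -[->|->].
  by rewrite preimage_set0; exact: open0.
by rewrite preimage_setT; exact: openT.
Qed.

(* The Sierpinski space, with open point o and closed point c. *)
Inductive sierpinski : Type := sier_o | sier_c.

HB.instance Definition _ := gen_eqMixin sierpinski.
HB.instance Definition _ := gen_choiceMixin sierpinski.

Definition sierpinski_open : set_system sierpinski :=
  [set set0; [set sier_o]; setT].

Lemma sierpinski_openP (U : set sierpinski) :
  sierpinski_open U <-> (U sier_c -> U sier_o).
Proof.
split=> [[[->|->]|->] //|UO].
have [Uc|Uc] := pselect (U sier_c).
  by right; rewrite /= -subTset => -[] _ //; exact: UO.
left; have [Uo|Uo] := pselect (U sier_o).
  by right; apply/seteqP; split=> [[]//|_ ->].
by left; rewrite /= -subset0 => -[].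
Qed.

Local Lemma sierpinski_openT : sierpinski_open setT.
Proof. by right. Qed.

Local Lemma sierpinski_openI : setI_closed sierpinski_open.
Proof.
move=> U V /sierpinski_openP UO /sierpinski_openP VO.
by apply/sierpinski_openP => -[/UO ? /VO ?]; split.
Qed.

Local Lemma sierpinski_open_bigU (I : Type) (F : I -> set sierpinski) :
  (forall i, sierpinski_open (F i)) -> sierpinski_open (\bigcup_i F i).
Proof.
move=> FO; apply/sierpinski_openP => -[i _ Fx].
by exists i => //; have /sierpinski_openP := FO i; apply.
Qed.

HB.instance Definition _ := isOpenTopological.Build sierpinski
  sierpinski_openT sierpinski_openI sierpinski_open_bigU.

Lemma sierpinski_openE : @open sierpinski = sierpinski_open.
Proof. by []. Qed.

(* The space a <- u -> b, with open point u and closed points a and b. *)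
Inductive fork : Type := fork_a | fork_u | fork_b.

HB.instance Definition _ := gen_eqMixin fork.
HB.instance Definition _ := gen_choiceMixin fork.

Definition fork_open : set_system fork :=
  [set set0; [set fork_u]; [set fork_a; fork_u]; [set fork_u; fork_b];
       [set fork_a; fork_u; fork_b]].

Lemma fork_openP (U : set fork) :
  fork_open U <-> (forall x, U x -> U fork_u).
Proof.
split=> [[[[[->|->]|->]|->]|->] // x|UO].
- by move=> _; right.
- by move=> _; left.
- by move=> _; left; right.
have [Uu|Uu] := pselect (U fork_u); last first.
  by do 4 left; rewrite /= -subset0 => x /UO.
have [Ua|Ua] := pselect (U fork_a); have [Ub|Ub] := pselect (U fork_b).
- right; apply/seteqP; split=> [[] _ /=|x]; first by left; left.
  + by left; right.
  + by right.
  + by case=> [[->|->]|->].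
- left; left; right; apply/seteqP; split=> [[] //= _|x [->|->] //].
    by left.
  by right.
- left; right; apply/seteqP; split=> [[] //= _|x [->|->] //].
    by left.
  by right.
- by do 3 left; right; apply/seteqP; split=> [[]//|x ->].
Qed.

Local Lemma fork_openT : fork_open setT.
Proof. exact/fork_openP. Qed.

Local Lemma fork_openI : setI_closed fork_open.
Proof.
move=> U V /fork_openP UO /fork_openP VO.
by apply/fork_openP => x [/UO ? /VO ?]; split.
Qed.

Local Lemma fork_open_bigU (I : Type) (F : I -> set fork) :
  (forall i, fork_open (F i)) -> fork_open (\bigcup_i F i).
Proof.
move=> FO; apply/fork_openP => x [i _ Fx].
by exists i => //; have /fork_openP := FO i; apply; exact: Fx.
Qed.

HB.instance Definition _ := isOpenTopological.Build fork
  fork_openT fork_openI fork_open_bigU.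

Lemma fork_openE : @open fork = fork_open.
Proof. by []. Qed.

Definition to_point (X : topologicalType) : continuousType X point_space :=
  cst (tt : point_space).

(* a is true and b is false. *)
Definition point_to_indiscrete :
    continuousType point_space (indiscrete_topology bool) :=
  cst (true : indiscrete_topology bool).

Definition sierpinski_to_indiscrete :
    continuousType sierpinski (indiscrete_topology sierpinski) :=
  mkcts (@indiscrete_continuous sierpinski sierpinski (fun x => x)).

(* The closed point c is sier_c and the open point u of the target is sier_o. *)
Definition fork_to_sierpinski_fun (x : fork) : sierpinski :=
  match x with
  | fork_u => sier_o
  | fork_a | fork_b => sier_c
  end.

Lemma fork_to_sierpinski_continuous : continuous fork_to_sierpinski_fun.
Proof.
apply/continuousP => U; rewrite sierpinski_openE fork_openE.
by move=> /sierpinski_openP UO; apply/fork_openP => -[]; rewrite /preimage//=.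
Qed.

Definition fork_to_sierpinski : continuousType fork sierpinski :=
  mkcts fork_to_sierpinski_continuous.

Inductive P1 : map_class :=
| P1_discrete : P1 (to_point two_point_space)
| P1_indiscrete : P1 point_to_indiscrete
| P1_sierpinski : P1 sierpinski_to_indiscrete
| P1_fork : P1 fork_to_sierpinski.

(* The library defines totally_disconnected through connected components; this
   is the formulation in terms of connected subsets (connected set0 holds in the
   library, hence the nonemptiness condition). *)
Lemma totally_disconnectedP (Q : topologicalType) :
  totally_disconnected [set: Q] <->
  (forall C : set Q, C !=set0 -> connected C -> exists x, C = [set x]).
Proof.
split=> [tdQ C [x Cx] cC|cQ x _].
  exists x; apply/seteqP; split; last by move=> _ ->.
  by rewrite -(tdQ x I); exact: connected_component_max.
have xx : connected_component [set: Q] x x by exact: connected_component_refl.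
have [||y cxy] := cQ (connected_component [set: Q] x).
- by exists x.
- exact: component_connected.
- by move: xx; rewrite cxy => /= ->.
Qed.

(* Main.v *)
Require Import Defs.
From mathcomp Require Import all_boot.
From mathcomp Require Import all_classical topology.
From mathcomp Require Import separation_axioms.

(** The maps [f : A -> B] in the left class of [P1] are quotient maps, and for
    such [f] the preimage of the closure [Z] of a point [b] is connected: two
    complementary clopen parts of [f @^-1` Z] define a map [A -> fork] over the
    map [B -> sierpinski] classifying [Z], and its lift to [B] sends [Z] to the
    closed point that is the image of [b]. A map from [A] to a totally
    disconnected space is therefore constant on fibres of [f], so that it
    factors through [B]. Conversely, if [C] is a nonempty connected subset of
    [Q], then [C -> point] is in the left class, and lifting the inclusion
    [C -> Q] along it makes [C] a singleton. *)

Set Implicit Arguments.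
Unset Strict Implicit.
Unset Printing Implicit Defensive.

Local Open Scope classical_set_scope.

Lemma continuous_to_sierpinski (X : topologicalType) (f : X -> sierpinski) :
  open (f @^-1` [set sier_o]) -> continuous f.
Proof.
move=> fo; apply/continuousP => U; rewrite sierpinski_openE.
move=> [[->|-> //]|->]; first by rewrite preimage_set0; exact: open0.
by rewrite preimage_setT; exact: openT.
Qed.

(** The point [fork_u] is dense, so a closed set containing it is the whole space; any other closed
    set lies in {a, b}. *)
Lemma continuous_to_fork (X : topologicalType) (f : X -> fork) :
  closed (f @^-1` [set fork_a]) -> closed (f @^-1` [set fork_b]) ->
  continuous f.
Proof.
move=> fa fb; apply/continuous_closedP => V; rewrite -openC.
rewrite fork_openE => /fork_openP VO.
have [Vu|nVu] := pselect (V fork_u).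
  rewrite (_ : V = setT) ?preimage_setT; first exact: closedT.
  by rewrite -subTset => x _; apply: contrapT => /VO; exact.
(* Intersecting with [[set _ | P]] keeps or empties [A], which treats all closed subsets of {a, b}
   at once. *)
have clif (P : Prop) (A : set X) : closed A -> closed (A `&` [set _ | P]).
  move=> cA; apply: closedI => //; have [/propT->|/propF->] := pselect P.
    exact: closedT.
  exact: closed0.
rewrite (_ : f @^-1` V =
    (f @^-1` [set fork_a] `&` [set _ | V fork_a]) `|`
    (f @^-1` [set fork_b] `&` [set _ | V fork_b])).
  by apply: closedU; exact: clif.
apply/seteqP; split=> [x /=|x /= [[->]|[->]]//].
by case: (f x) => // Vx; [left|right].
Qed.

Lemma fork_closed_point (x : fork) : x <> fork_u -> closed [set x].
Proof.
move=> xu; rewrite -openC fork_openE.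
by apply/fork_openP => y _ /= ux; apply: xu.
Qed.

Lemma fork_open_setU_u (x : fork) : open [set y | y = x \/ y = fork_u].
Proof. by rewrite fork_openE; apply/fork_openP => y _; right. Qed.

Lemma connected_setT_clopen (X : topologicalType) (U : set X) :
  connected [set: X] -> U !=set0 -> clopen U -> U = setT.
Proof.
by move=> cX U0 [oU cU]; apply: cX => //; exists U => //; rewrite setTI.
Qed.

(** Lets a connected subset be the domain of a map: a clopen part of [set_type C] is the trace of an
    open and of a closed set of [X]. *)
Lemma connected_set_type (X : topologicalType) (C : set X) :
  connected C -> connected [set: set_type C].
Proof.
move=> cC B [x Bx] [_ [U oU <-] BU] [D cD BD].
have [V oV DV] : open (~` D) by rewrite openC.
rewrite setTI in BU; rewrite setTI in BD.
have UE y : B y <-> U (val y) by rewrite BU.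
have VE y : B y <-> ~ V (val y).
  rewrite BD; have := congr1 (fun A => A y) DV; rewrite /preimage/= => ->.
  by split=> [? []//|/contrapT].
have CU : C `&` U = C.
  apply: cC.
  - by exists (val x); split; [exact/set_mem/(valP x)|exact/UE].
  - by exists U.
  - exists (~` V); first exact: open_closedC.
    by apply/seteqP; split=> y [Cy Py]; split=> //;
       [apply/(VE (exist _ y (mem_set Cy)))/UE|
        apply/(UE (exist _ y (mem_set Cy)))/VE].
rewrite -subTset => y _; apply/UE.
have : C (val y) by exact/set_mem/(valP y).
by rewrite -{1}CU => -[].
Qed.

Lemma connected_to_point_left_class (X : topologicalType) :
  [set: X] !=set0 -> connected [set: X] -> left_class P1 (to_point X).
Proof.
move=> [x0 _] cX _ _ _ [] t s ts.
- have tE : t @^-1` [set t x0] = setT.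
    apply: connected_setT_clopen => //; first by exists x0.
    apply: preimage_clopen; last exact: cts_fun.
    by split; [exact: discrete_open|exact: discrete_closed].
  exists (cst (t x0)); split; apply/funext => x /=.
    by have : (t @^-1` [set t x0]) x by rewrite tE.
  by case: (s x).
(* Nonemptiness is what forces [s tt] to be [true]: the square commutes at [x0]. *)
- exists idfun; split; apply/funext => x /=; first by case: (t x).
  by case: x; exact: (congr1 (@^~ x0) ts).
- exists (cst (s tt : sierpinski)); split; apply/funext => x /=.
    by symmetry; exact: (congr1 (@^~ x) ts).
  by case: x.
- have ft x : fork_to_sierpinski_fun (t x) = s tt by exact: (congr1 (@^~ x) ts).
  suff tE x : t x = t x0.
    exists (cst (t x0)); split; apply/funext => x //=.
    by case: x; exact: ft.
  (* All of [t] lies in one fibre of the fork map: {u} in the first case, {a, b} in the second. *)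
  have [x0u|x0u] := pselect (t x0 = fork_u).
    by have := ft x; rewrite -(ft x0) x0u; case: (t x).
  suff : (t @^-1` [set t x0]) x by [].
  suff -> : t @^-1` [set t x0] = setT by [].
  apply: connected_setT_clopen => //; first by exists x0.
  split; last first.
    apply: preimage_closed => [? _|]; first exact: cts_fun.
    exact: fork_closed_point.
  (* Here [t] avoids [fork_u], so adding this point to [t x0] gives an open set with the same
     preimage. *)
  rewrite (_ : _ @^-1` _ = t @^-1` [set y | y = t x0 \/ y = fork_u]).
    apply: open_comp; last exact: fork_open_setU_u.
    by move=> *; exact: cts_fun.
  apply/seteqP; split=> y /= ; first by left.
  case=> // yu; have := ft y; rewrite -(ft x0) yu.
  by case: (t x0) x0u.
Qed.

Section left_class_P1.
Variables (A B : topologicalType) (f : continuousType A B).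
Hypothesis fP : left_class P1 f.

(** The indicator of the image of [f] lifts through the point [true], so it is constant. *)
Lemma left_class_surj (b : B) : exists a, f a = b.
Proof.
pose s (b : B) : indiscrete_topology bool := `[< exists a, f a = b >].
have [|h [_ sE]] := @fP _ _ _ P1_indiscrete (to_point A)
  (mkcts (@indiscrete_continuous _ _ s)).
  apply/funext => a /=; rewrite /mkcts/s/=.
  by symmetry; apply/asboolP; exists a.
have sb : true = s b :> bool := congr1 (@^~ b) sE.
by apply/asboolP; exact: esym sb.
Qed.

(** The indicator of [U] becomes continuous after composition with [f]; the lift agrees with it
    pointwise, so it is continuous itself. *)
Lemma left_class_quotient (U : set B) : open (f @^-1` U) -> open U.
Proof.
move=> oU.
pose s (b : B) : sierpinski := if `[< U b >] then sier_o else sier_c.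
have so b : s b = sier_o <-> U b by rewrite /s; case: asboolP.
have sfc : continuous (s \o f).
  apply: continuous_to_sierpinski; rewrite (_ : _ @^-1` _ = f @^-1` U)//.
  by apply/seteqP; split=> a /so.
have [//|h [_ hs]] := @fP _ _ _ P1_sierpinski (mkcts sfc)
  (mkcts (@indiscrete_continuous _ sierpinski s)).
have hE b : h b = s b by exact: (congr1 (@^~ b) hs).
rewrite (_ : U = h @^-1` [set sier_o]); last first.
  by apply/seteqP; split=> b /=; rewrite hE => /so.
apply: open_comp; first by move=> *; exact: cts_fun.
by rewrite sierpinski_openE; apply/sierpinski_openP.
Qed.

Lemma left_class_preimage_closure1 (b : B) :
  connected (f @^-1` closure [set b]).
Proof.
set Z := closure [set b]; set K := f @^-1` Z.
have cZ : closed Z by exact: closed_closure.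
have cK : closed K by apply: preimage_closed => [? _|//]; exact: cts_fun.
move=> E E0 [U oU EU] [D cD ED].
have cE : closed E by rewrite ED; exact: closedI.
have EK : E `<=` K by rewrite EU => a [].
(* This uses that [E] is relatively open in [K]; continuity of [t] needs both parts closed in
   [A]. *)
have cKE : closed (K `\` E).
  rewrite (_ : K `\` E = K `&` ~` U).
    by apply: closedI => //; exact: open_closedC.
  by rewrite EU setDE setCI setIUr setICr set0U.
pose t a := if `[< E a >] then fork_a
            else if `[< K a >] then fork_b else fork_u.
have ta a : t a = fork_a <-> E a.
  by rewrite /t; case: asboolP => Ea; [|case: asboolP]; split.
have tb a : t a = fork_b <-> (K `\` E) a.
  rewrite /t; case: asboolP => [Ea|nEa]; first by split=> // -[_ /(_ Ea)].
  by case: asboolP => [Ka|nKa]; split=> // -[/nKa].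
have tc : continuous t.
  apply: continuous_to_fork.
    by rewrite (_ : _ @^-1` _ = E)//; apply/seteqP; split=> a /ta.
  by rewrite (_ : _ @^-1` _ = K `\` E)//; apply/seteqP; split=> a /tb.
pose s (y : B) : sierpinski := if `[< Z y >] then sier_c else sier_o.
have sc : continuous s.
  apply: continuous_to_sierpinski; rewrite (_ : _ @^-1` _ = ~` Z).
    exact: closed_openC.
  by apply/seteqP; split=> y /=; rewrite /s; case: asboolP.
have [|h [ht hs]] := @fP _ _ _ P1_fork (mkcts tc) (mkcts sc).
  apply/funext => a.
  change (fork_to_sierpinski_fun (t a) =
    if `[< K a >] then sier_c else sier_o).
  rewrite /t; case: (asboolP (E a)) => [/EK Ka|_]; first by rewrite asboolT.
  by case: (asboolP (K a)).
have hta a : h (f a) = t a by exact: (congr1 (@^~ a) ht).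
have hZ y : Z y -> h y = h b.
  have Zb : Z b by exact: subset_closure.
  have hbu : h b <> fork_u.
    have : fork_to_sierpinski_fun (h b) = s b by exact: (congr1 (@^~ b) hs).
    by rewrite /s asboolT//; case: (h b).
  (* Lying over [sier_c], the point [h b] is closed, so its preimage is closed and contains the
     closure of [b]. *)
  suff : Z `<=` h @^-1` [set h b] by apply.
  rewrite /Z (@closure_id _ (h @^-1` [set h b])).1.
    by apply: closureS => _ ->.
  apply: preimage_closed => [? _|]; first exact: cts_fun.
  exact: fork_closed_point.
apply/seteqP; split=> // a Ka; case: E0 => e Ee; apply/ta.
by rewrite -hta (hZ _ Ka) -(hZ _ (EK _ Ee)) hta; exact/ta.
Qed.

End left_class_P1.

Theorem lemma2p12 (Q : topologicalType) :
  totally_disconnected [set: Q]%classic <-> left_right_class P1 (to_point Q).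
Proof.
split=> [tdQ A B f fP t s _|QP].
  (* [r] is a mere set-theoretic section; [t \o r] is continuous because [f] is a quotient map. *)
  have [r rK] := choice (left_class_surj fP).
  (* Both [a] and [r (f a)] lie in [K], whose image under [t] is connected and hence one point. *)
  have tr a : t (r (f a)) = t a.
    set K := f @^-1` closure [set f a].
    have [||x tKx] := (totally_disconnectedP Q).1 tdQ (t @` K).
    - by exists (t a), a => //; exact: subset_closure.
    - apply: connected_continuous_connected.
        exact: left_class_preimage_closure1.
      by apply: continuous_subspaceT => ?; exact: cts_fun.
    have tK c : K c -> t c = x.
      by move=> Kc; rewrite -[_ = _]/([set x] (t c)) -tKx; exists c.
    by rewrite !tK // /K /=; apply: subset_closure; rewrite /= ?rK.
  have hc : continuous (t \o r).
    apply/continuousP => U oU; apply: (left_class_quotient fP).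
    rewrite (_ : _ @^-1` _ = t @^-1` U).
      by apply: open_comp => [? _|//]; exact: cts_fun.
    by apply/seteqP; split=> a; rewrite /preimage/= tr.
  exists (mkcts hc); split; first by apply/funext.
  by apply/funext => b /=; case: (s b).
apply/totally_disconnectedP => C [x Cx] cC.
have [||//|h [hv _]] :=
  @QP _ _ _ (@connected_to_point_left_class (set_type C) _ _)
    (mkcts (@initial_continuous (set_type C) Q set_val)) idfun.
- by exists (exist _ x (mem_set Cx)).
- exact: connected_set_type.
(* The inclusion of [C] factors through the point via [h]. *)
have hE y (Cy : C y) : y = h tt.
  by have := congr1 (@^~ (exist _ y (mem_set Cy))) hv.
exists x; apply/seteqP; split=> [y Cy|_ -> //].
by rewrite /= (hE _ Cy) (hE _ Cx).
Qed.
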